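(* Let $\mathcal{G}=(V_\mathcal{G},E^+_\mathcal{G},E^-_\mathcal{G},L_\mathcal{G})$ be a signed graph with $V_\mathcal{G}=[n]$. Then the following are equivalent: (i) $\mathcal{G}$ has an even (respectively, odd) full cyclic permutation ordering; (ii) the unsigned multigraph $\bar{\mathcal{G}}$ has a full cyclic permutation ordering and $|L_\mathcal{G}|$ is even (respectively, odd).
   Context: Let $n\ge1$, $[n]=\{1,\dots,n\}$, $I_n=\{-n,\dots,-1,1,\dots,n\}$. The hyperoctahedral group is $\mathfrak{H}_n=\{\eta\in\mathfrak{S}_{I_n}:\eta(-i)=-\eta(i)\ \forall i\in I_n\}$; $\mathfrak{S}_n$ is regarded as a subgroup of $\mathfrak{H}_n$ (a permutation $\sigma$ of $[n]$ extended by $\sigma(-i)=-\sigma(i)$). Signed transpositions: for distinct $i,j\in[n]$, $(i\ j)$ swaps $i\leftrightarrow j$ (and $-i\leftrightarrow -j$), fixing everything else; $(i\ {-j})$ sends $i\mapsto -j$, $j\mapsto -i$ (and correspondingly on negatives), fixing everything else; for $i\in[n]$, the inversion transposition $(i\ {-i})$ sends $i\mapsto -i$ and fixes all other elements of $[n]$. An element $\eta\in\mathfrak{H}_n$ is an even (resp. odd) full cyclic permutation if there are an ordering $i_1,\dots,i_n$ of $[n]$ and signs $\epsilon_1,\dots,\epsilon_n\in\{+1,-1\}$ with $\eta(i_k)=\epsilon_k i_{k+1}$ for all $k$ (indices mod $n$, $i_{n+1}=i_1$) and $\epsilon_1\cdots\epsilon_n=+1$ (resp. $-1$). A signed graph is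 a quadruple $\mathcal{G}=(V_\mathcal{G},E^+_\mathcal{G},E^-_\mathcal{G},L_\mathcal{G})$ with $V_\mathcal{G}=[n]$, $E^+_\mathcal{G},E^-_\mathcal{G}$ sets of 2-element subsets of $V_\mathcal{G}$ (positive and negative edges), and $L_\mathcal{G}\subseteq V_\mathcal{G}$ (loops); its edge set is the disjoint union $E_\mathcal{G}=E^+_\mathcal{G}\sqcup E^-_\mathcal{G}\sqcup L_\mathcal{G}$. To $e\in E_\mathcal{G}$ associate $\tau_e=(i\ j)$ if $e=\{i,j\}\in E^+_\mathcal{G}$, $\tau_e=(i\ {-j})$ if $e=\{i,j\}\in E^-_\mathcal{G}$, $\tau_e=(i\ {-i})$ if $e=i\in L_\mathcal{G}$. An edge ordering is a linear order $\omega=(e_1,\dots,e_m)$ of $E_\mathcal{G}$, and $\pi_\omega=\tau_{e_m}\cdots\tau_{e_1}\in\mathfrak{H}_n$ (composition of maps). $\omega$ is an even (resp. odd) full cyclic permutation ordering if $\pi_\omega$ is an even (resp. odd) full cyclic permutation. $\bar{\mathcal{G}}$ denotes the unsigned multigraph on vertex set $[n]$ whose edge multiset is $E^+_\mathcal{G}\sqcup E^-_\mathcal{G}$. For an unsigned (multi)graph, each edge $\{i,j\}$ gives the transposition $(i\ j)\in\mathfrak{S}_n$, an edge ordering $(e_1,\dots,e_m)$ gives the product $\tau_{e_m}\cdots\tau_{e_1}\in\mathfrak{S}_n$, and the ordering is a full cyclic permutation ordering if this product is a cycle of length $n$. *)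

(* Defs.v *)
From mathcomp Require Import all_boot all_order all_fingroup all_algebra.

Set Implicit Arguments.
Unset Strict Implicit.
Unset Printing Implicit Defensive.

Import GRing.Theory.
Local Open Scope ring_scope.

(* The vertex set [n] is 'I_n (shifted to start at 0).  The set I_n of the
   2n signed indices is 'I_n * bool, where (i, false) stands for i and
   (i, true) for -i. *)
Notation signed n := ('I_n * bool)%type.

Definition spos n (i : 'I_n) : signed n := (i, false).
Definition sneg n (i : 'I_n) : signed n := (i, true).
Definition sopp n (x : signed n) : signed n := (x.1, ~~ x.2).

Definition hyperoctahedral n : {set {perm signed n}} :=
  [set eta : {perm signed n} | [forall x, eta (sopp x) == sopp (eta x)]].

(* (i j) and (i -j) are meant for i != j. *)
Definition pos_transp n (i j : 'I_n) : {perm signed n} :=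
  (tperm (spos i) (spos j) * tperm (sneg i) (sneg j))%g.
Definition neg_transp n (i j : 'I_n) : {perm signed n} :=
  (tperm (spos i) (sneg j) * tperm (sneg i) (spos j))%g.
Definition inv_transp n (i : 'I_n) : {perm signed n} :=
  tperm (spos i) (sneg i).

(* The ordering i_1, ..., i_n of [n] is a bijection i : 'S_n, ordS is the
   successor of indices mod n, and the sign epsilon_k is (-1) ^+ eps k, so that
   epsilon_k i_(k+1) is the signed index (i (ordS k), eps k). *)
Definition signed_full_cyclic n (s : int) (eta : {perm signed n}) : Prop :=
  eta \in hyperoctahedral n /\
  exists (i : 'S_n) (eps : 'I_n -> bool),
    (forall k, eta (spos (i k)) = (i (ordS k), eps k)) /\
    \prod_(k < n) (-1) ^+ eps k = s.

Definition even_full_cyclic n (eta : {perm signed n}) : Prop :=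
  signed_full_cyclic 1 eta.
Definition odd_full_cyclic n (eta : {perm signed n}) : Prop :=
  signed_full_cyclic (-1) eta.

(* sigma is a cycle (i_1 ... i_n) of length n. *)
Definition full_cycle n (sigma : 'S_n) : Prop :=
  exists i : 'S_n, forall k, sigma (i k) = i (ordS k).

Definition linear_ordering (T : finType) (w : seq T) : Prop :=
  uniq w /\ forall x, x \in w.

(* Applies f to the two elements of e; the value does not depend on their order
   when f i j = f j i, as is the case for every f used below. *)
Definition on_pair n (gT : finGroupType) (f : 'I_n -> 'I_n -> gT)
    (e : {set 'I_n}) : gT :=
  if enum e is [:: i; j] then f i j else 1%g.

Record signed_graph (n : nat) := SignedGraph {
  pos_edges : {set {set 'I_n}};
  neg_edges : {set {set 'I_n}};
  loops : {set 'I_n};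
  card_pos_edges : forall e, e \in pos_edges -> #|e| = 2%N;
  card_neg_edges : forall e, e \in neg_edges -> #|e| = 2%N
}.

Definition sedge n (G : signed_graph n) : finType :=
  ({e | e \in pos_edges G} + {e | e \in neg_edges G} + {i | i \in loops G})%type.

Definition stau n (G : signed_graph n) (e : sedge G) : {perm signed n} :=
  match e with
  | inl (inl e) => on_pair (@pos_transp n) (val e)
  | inl (inr e) => on_pair (@neg_transp n) (val e)
  | inr i => inv_transp (val i)
  end.

(* The product s * t of permutations is x |-> t (s x), so the composition of
   maps tau_(e_m) ... tau_(e_1) is the product taken in the order of w. *)
Definition spi n (G : signed_graph n) (w : seq (sedge G)) : {perm signed n} :=
  (\prod_(e <- w) stau e)%g.

Definition even_full_cyclic_ordering n (G : signed_graph n)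
    (w : seq (sedge G)) : Prop :=
  linear_ordering w /\ even_full_cyclic (spi w).
Definition odd_full_cyclic_ordering n (G : signed_graph n)
    (w : seq (sedge G)) : Prop :=
  linear_ordering w /\ odd_full_cyclic (spi w).

Record multigraph (n : nat) := Multigraph {
  medge : finType;
  mends : medge -> {set 'I_n};
  card_mends : forall e, #|mends e| = 2%N
}.

Definition mpi n (H : multigraph n) (w : seq (medge H)) : 'S_n :=
  (\prod_(e <- w) on_pair (@tperm 'I_n) (mends e))%g.

Definition full_cyclic_ordering n (H : multigraph n)
    (w : seq (medge H)) : Prop :=
  linear_ordering w /\ full_cycle (mpi w).

Definition underlying_ends n (G : signed_graph n)
    (e : {e | e \in pos_edges G} + {e | e \in neg_edges G}) : {set 'I_n} :=
  match e with inl e => val e | inr e => val e end.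

Lemma card_underlying_ends n (G : signed_graph n) e :
  #|@underlying_ends n G e| = 2%N.
Proof.
by case: e => e /=; [exact: card_pos_edges (valP e)
                    |exact: card_neg_edges (valP e)].
Qed.

Definition underlying n (G : signed_graph n) : multigraph n :=
  Multigraph (@card_underlying_ends n G).

(* Main.v *)
Require Import Defs.
From mathcomp Require Import all_boot all_order all_fingroup all_algebra.

(** Forgetting signs is a homomorphism from the hyperoctahedral group onto the
    symmetric group, and the product of the signs of [eta 1, ..., eta n] is a
    homomorphism to [{1, -1}].  Positive and negative edges both map to
    [((i j), 1)], loops map to [(1, -1)].  Hence the cycle condition on
    [spi w] only sees the non-loop edges of [w], in their order, and the parity
    condition only sees the number of loops. *)

Set Implicit Arguments.
Unset Strict Implicit.
Unset Printing Implicit Defensive.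

Import GRing.Theory.

(** [signed_lift sigma b eta]: [eta] is hyperoctahedral, its image in the
    symmetric group is [sigma], and the product of its signs is [(-1) ^+ b]. *)
Definition signed_lift n (sigma : 'S_n) (b : bool) (eta : {perm signed n}) :=
  exists2 f : 'I_n -> bool,
    forall i s, eta (i, s) = (sigma i, s (+) f i) & \big[addb/false]_i f i = b.

Section SignedLift.

Variable n : nat.
Implicit Types (i j : 'I_n) (sigma : 'S_n) (eta : {perm signed n}).

Lemma signed_lift1 : signed_lift 1%g false (1%g : {perm signed n}).
Proof.
exists (fun=> false) => [i s|]; first by rewrite !perm1 addbF.
by rewrite big1.
Qed.

(** The product [eta1 * eta2] applies [eta1] first, so the sign that [eta2] contributes at [i] is
    read at [sigma1 i]. Summed over all [i], this shift by a bijection disappears and the two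
    parities add. *)
Lemma signed_liftM sigma1 sigma2 b1 b2 eta1 eta2 :
  signed_lift sigma1 b1 eta1 -> signed_lift sigma2 b2 eta2 ->
  signed_lift (sigma1 * sigma2)%g (b1 (+) b2) (eta1 * eta2)%g.
Proof.
move=> [f1 lift1 <-] [f2 lift2 <-].
exists (fun i => f1 i (+) f2 (sigma1 i)) => [i s|].
  by rewrite !permM lift1 lift2 addbA.
by rewrite big_split /=; congr addb; rewrite [RHS](reindex_perm sigma1).
Qed.

Lemma addb_big_eq1 i : \big[addb/false]_k (k == i) = true.
Proof. by rewrite (bigD1 i) //= eqxx big1 // => k /negbTE. Qed.

(** Covers both edge signs: [b = false] is [pos_transp], [b = true] is [neg_transp]. A negative edge
    flips the sign at both [i] and [j], so its two signs cancel. *)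
Lemma signed_lift_transp i j b : i != j ->
  signed_lift (tperm i j) false
    (tperm (i, false) (j, b) * tperm (i, true) (j, ~~ b))%g.
Proof.
move=> ij; have ji : j == i = false by rewrite eq_sym (negbTE ij).
exists (fun k => b && ((k == i) (+) (k == j))) => [k s|]; last first.
  case: b; first by rewrite big_split /= !addb_big_eq1.
  by rewrite big1.
rewrite permM; case: (tpermP i j k) => [->|->|/eqP/negbTE ki /eqP/negbTE kj].
- by case: b s => [] []; rewrite !permE /= !(xpair_eqE, eqxx, negbTE ij) /=
    ?(xpair_eqE, eqxx, ji, andbF).
- by case: b s => [] []; rewrite !permE /= !(xpair_eqE, eqxx, ji) /=
    ?(xpair_eqE, eqxx, negbTE ij, ji, andbF).
by rewrite !permE /= !(xpair_eqE, ki, kj) andbF addbF.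
Qed.

Lemma signed_lift_inv_transp i : signed_lift 1%g true (inv_transp i).
Proof.
exists (fun k => k == i) => [k s|]; last exact: addb_big_eq1.
rewrite permE /= perm1 /spos /sneg !xpair_eqE.
by case: s; case: eqP => //= ->.
Qed.

(** The cycle condition forces [eps k = f (i k)]; hence the product of signs along the cycle merely
    reorders the product over all vertices, whatever the enumeration [i]. *)
Lemma signed_full_cyclic_lift sigma b eta (z : int) :
  signed_lift sigma b eta ->
  signed_full_cyclic z eta <-> full_cycle sigma /\ ((-1) ^+ b)%R = z.
Proof.
move=> [f lift sumf].
have prodf (i : 'S_n) : (\prod_(k < n) (-1) ^+ f (i k) = (-1) ^+ b :> int)%R.
  rewrite -sumf [in RHS](reindex_perm i) /=.
  by elim/big_rec2: _ => // k c x _ ->; rewrite signr_addb.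
split=> [[_ [i [eps [etaE <-]]]]|[[i sigmaE] <-]].
  have stepE k : (sigma (i k), f (i k)) = (i (ordS k), eps k).
    by rewrite -etaE /spos lift.
  split; first by exists i => k; have [] := stepE k.
  by rewrite -(prodf i); apply: eq_bigr => k _; have [_ ->] := stepE k.
split.
  by rewrite inE; apply/forallP=> -[k s]; rewrite /sopp /= !lift addNb.
by exists i, (fun k => f (i k)); split=> // k; rewrite /spos lift sigmaE.
Qed.

(** The endpoints are chosen before [f], so that one pair [i], [j] serves both the signed and the
    unsigned transposition of an edge. *)
Lemma on_pair_cards2 (e : {set 'I_n}) : #|e| = 2%N ->
  exists i j, i != j /\
    forall (gT : finGroupType) (f : 'I_n -> 'I_n -> gT), on_pair f e = f i j.
Proof.
rewrite cardE; have := enum_uniq e; rewrite /on_pair.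
case: (enum e) => [|i [|j [|k s]]] //=.
by rewrite inE andbT => ij _; exists i, j.
Qed.

End SignedLift.

Section SumOrdering.

Variables A B : Type.

Definition lefts : seq (A + B) -> seq A :=
  pmap (fun x => if x is inl a then Some a else None).
Definition rights : seq (A + B) -> seq B :=
  pmap (fun x => if x is inr b then Some b else None).

Lemma lefts_cat_inl_inr u v : lefts (map inl u ++ map inr v) = u.
Proof.
rewrite /lefts pmap_cat map_pK // [pmap _ _](_ : _ = [::]) ?cats0 //.
by elim: v.
Qed.

End SumOrdering.

Section LinearOrdering.

Variables A B : finType.

Lemma linear_ordering_lefts (w : seq (A + B)) :
  linear_ordering w -> linear_ordering (lefts w).
Proof.
move=> [uniq_w in_w]; split=> [|a].
  by apply: (pmap_uniq (g := inl)) uniq_w; case.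
by rewrite mem_pmap; apply/mapP; exists (inl a).
Qed.

Lemma linear_ordering_rights (w : seq (A + B)) :
  linear_ordering w -> linear_ordering (rights w).
Proof.
move=> [uniq_w in_w]; split=> [|b].
  by apply: (pmap_uniq (g := inr)) uniq_w; case.
by rewrite mem_pmap; apply/mapP; exists (inr b).
Qed.

Lemma linear_ordering_cat (u : seq A) (v : seq B) :
  linear_ordering u -> linear_ordering v ->
  linear_ordering (map inl u ++ map inr v).
Proof.
move=> [uniq_u in_u] [uniq_v in_v]; split=> [|x].
  rewrite cat_uniq !map_inj_uniq ?uniq_u ?uniq_v => [|? ? []|? ? []] //=.
  by rewrite andbT; apply/hasPn=> _ /mapP[b _ ->]; apply/negP=> /mapP[].
by rewrite mem_cat; case: x => x; rewrite map_f ?orbT.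
Qed.

Lemma size_linear_ordering (w : seq A) : linear_ordering w -> size w = #|A|.
Proof.
move=> [uniq_w in_w]; rewrite -(card_uniqP uniq_w).
by apply: eq_card => x; rewrite in_w.
Qed.

End LinearOrdering.

Section SignedGraph.

Variables (n : nat) (G : signed_graph n).

Lemma signed_lift_stau_inl (e : medge (underlying G)) :
  signed_lift (on_pair (@tperm 'I_n) (mends e)) false (stau (inl e : sedge G)).
Proof.
have [i [j [ij pairE]]] := on_pair_cards2 (card_mends e).
by case: e pairE => e /= pairE; rewrite !pairE;
  [exact: signed_lift_transp false ij|exact: signed_lift_transp true ij].
Qed.

Lemma signed_lift_spi (w : seq (sedge G)) :
  signed_lift (Defs.mpi (lefts w : seq (medge (underlying G))))
    (odd (size (rights w))) (spi w).
Proof.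
rewrite /spi /Defs.mpi; elim: w => [|[e|e] w IHw] /=.
- by rewrite !big_nil; exact: signed_lift1.
- by rewrite !big_cons; exact: signed_liftM (signed_lift_stau_inl e) IHw.
(* A loop is absent from [lefts] and adds one to the size of [rights]: it contributes the factor [1]
   and the parity [true]. *)
rewrite [in X in signed_lift _ _ X]big_cons -[X in signed_lift X]mul1g -addTb.
exact: signed_liftM (signed_lift_inv_transp _) IHw.
Qed.

Lemma signed_full_cyclic_orderingP (b : bool) :
  (exists w : seq (sedge G),
     linear_ordering w /\ signed_full_cyclic ((-1) ^+ b)%R (spi w)) <->
  (exists w : seq (medge (underlying G)), full_cyclic_ordering w) /\
  odd #|loops G| = b.
Proof.
have spiP (w : seq (sedge G)) : linear_ordering w ->
    signed_full_cyclic ((-1) ^+ b)%R (spi w) <->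
    full_cycle (Defs.mpi (lefts w : seq (medge (underlying G)))) /\
    odd #|loops G| = b.
  move=> ord_w.
  have [] := signed_full_cyclic_lift ((-1) ^+ b)%R (signed_lift_spi w).
  (* A complete ordering lists each loop exactly once, so the parity no longer depends on [w]. *)
  rewrite (size_linear_ordering (linear_ordering_rights ord_w)) card_sig.
  move=> cyc_lift lift_cyc; split=> [/cyc_lift[cyc_w eq_b]|[cyc_w eq_b]].
    (* Distinct parities would equate [1] and [-1] in [int]. *)
    by split=> //; move: eq_b; case: (odd _); case: (b).
  by apply: lift_cyc; rewrite eq_b.
split=> [[w [ord_w /(spiP _ ord_w)[cyc_w eq_b]]]|[[u [ord_u cyc_u]] eq_b]].
  split=> //; exists (lefts w); split=> //.
  exact: linear_ordering_lefts.
(* Loops have trivial unsigned image, so they can be appended after the edges, in any order. *)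
pose v := enum {: {i | i \in loops G}}.
have ord_v : linear_ordering v.
  by split=> [|x]; [exact: enum_uniq|rewrite mem_enum].
have ord_w := linear_ordering_cat ord_u ord_v.
exists (map inl u ++ map inr v); split=> //.
by apply/(spiP _ ord_w); rewrite lefts_cat_inl_inr.
Qed.

End SignedGraph.

Theorem theorem1p8 (n : nat) (hn : (1 <= n)%N) (G : signed_graph n) :
  ((exists w : seq (sedge G), even_full_cyclic_ordering w) <->
   ((exists w : seq (medge (underlying G)), full_cyclic_ordering w) /\
    ~~ odd #|loops G|)) /\
  ((exists w : seq (sedge G), odd_full_cyclic_ordering w) <->
   ((exists w : seq (medge (underlying G)), full_cyclic_ordering w) /\
    odd #|loops G|)).
Proof.
split; last exact: (signed_full_cyclic_orderingP G true).
have [cycP Pcyc] := signed_full_cyclic_orderingP G false.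
by split=> [/cycP[? /negbT]|[? /negbTE odd_loops]]; last exact: Pcyc.
Qed.
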